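(* Let $\epsilon < \frac{1}{23}$ be a real number. Let $G$ be a finite bipartite graph with bipartition $(L,R)$ such that every vertex of $L$ has degree at most $3$ and for every subset $A \subseteq L$, $|N_G(A)| \geq (2-\epsilon)|A|$. Then there exists a $(2,4)$-matching in $G$ covering $L$.
   Context: For a bipartite graph $G$ with bipartition $(L,R)$, a $(2,4)$-matching in $G$ is a subgraph $F$ of $G$ such that (1) each connected component of $F$ is a tree with at most $4$ edges, and (2) each vertex in $V(F)\cap L$ has degree exactly $2$ in $F$. A $(2,4)$-matching $F$ covers a set of vertices $S$ if $S \subseteq V(F)$. $N_G(A)$ denotes the set of neighbours in $G$ of vertices of $A$. *)

(* Defs.v *)
From mathcomp Require Import all_boot all_order all_algebra reals.

Set Implicit Arguments.
Unset Strict Implicit.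
Unset Printing Implicit Defensive.

(* A simple graph carries its own vertex set inside the ambient finite type V,
   so that subgraphs and components are again graphs over V. *)
Record graph (V : finType) := Graph {
  verts : {set V};
  adj : rel V;
  adj_sym : symmetric adj;
  adj_irrefl : irreflexive adj;
  adj_verts : forall x y, adj x y -> x \in verts
}.

Section Graphs.

Variable V : finType.
Implicit Types (G F : graph V) (A L R : {set V}) (x y : V).

Definition edges G : {set {set V}} :=
  [set [set p.1; p.2] | p : V * V & adj G p.1 p.2].

Definition degree G x : nat := #|[set y | adj G x y]|.

Definition neighbours G A : {set V} := [set y | [exists x in A, adj G x y]].

Definition bipartition G L R : Prop :=
  [/\ L :|: R = verts G, [disjoint L & R] &
      forall x y, adj G x y ->
        (x \in L /\ y \in R) \/ (x \in R /\ y \in L)].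

Definition subgraph F G : Prop :=
  verts F \subset verts G /\ forall x y, adj F x y -> adj G x y.

Definition induced_adj G A : rel V :=
  [rel x y | [&& x \in A, y \in A & adj G x y]].

Lemma induced_adj_sym G A : symmetric (induced_adj G A).
Proof. by move=> x y; rewrite /induced_adj /= adj_sym andbCA. Qed.

Lemma induced_adj_irrefl G A : irreflexive (induced_adj G A).
Proof. by move=> x; rewrite /induced_adj /= adj_irrefl !andbF. Qed.

Lemma induced_adj_verts G A x y :
  induced_adj G A x y -> x \in verts G :&: A.
Proof. by case/and3P=> xA _ /adj_verts xG; rewrite inE xG. Qed.

Definition induced G A : graph V :=
  Graph (@induced_adj_sym G A) (@induced_adj_irrefl G A)
        (@induced_adj_verts G A).

(* Meaningful for x \in verts G. *)
Definition component G x : graph V :=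
  induced G [set y | connect (adj G) x y].

Definition connected_graph G : Prop :=
  verts G != set0 /\
  forall x y, x \in verts G -> y \in verts G -> connect (adj G) x y.

(* The bound on the length excludes the degenerate closed walks [::] and
   [:: x; y], which satisfy ucycle without being cycles of the graph. *)
Definition acyclic G : Prop :=
  forall c : seq V, 2 < size c -> ~ ucycle (adj G) c.

Definition tree G : Prop := connected_graph G /\ acyclic G.

(* The (2,4)-matchings of G, relative to the side L of its bipartition. *)
Definition matching24 G L F : Prop :=
  [/\ subgraph F G,
      forall x, x \in verts F ->
        tree (component F x) /\ #|edges (component F x)| <= 4 &
      forall x, x \in verts F :&: L -> degree F x = 2].

Definition covers F A : Prop := A \subset verts F.

End Graphs.

(* Main.v *)
(* A (2,4)-matching is a vertex-disjoint union of paths p-l-q and p-l-r-k-q with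
   l, k in L.  Cover A by induction on A, calling a neighbour of l private if l
   is its only neighbour in A.  If some l has two private neighbours p, q, use
   p-l-q; if l and k have private neighbours p and q, and r is adjacent to l and
   k but to no other vertex of A, use p-l-r-k-q.  In both cases the R-vertices
   used are not neighbours of the rest of A.  If neither applies, charge an edge
   l-r with l in A by 5 if r is private to l, otherwise by 2 if l has a private
   neighbour and by 3 if it has none.  Then every r in N(A) collects at least 5
   and every l at most max(5+2+2, 3+3+3) = 9, so |N(A)| <= 9/5 |A|, contrary to
   the expansion hypothesis (for which eps < 1/5 would suffice). *)
Require Import Defs.
From mathcomp Require Import all_boot all_order all_algebra reals.
From mathcomp Require Import zify lra.
Import Order.TTheory GRing.Theory Num.Theory.
Local Open Scope ring_scope.

Set Implicit Arguments.
Unset Strict Implicit.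
Unset Printing Implicit Defensive.

(** * Vertex-disjoint unions of paths as graphs *)

Section PathUnion.

Local Open Scope nat_scope.

Variable V : finType.
Implicit Types (s : seq (seq V)) (t c : seq V) (x y z : V).

(** Positions are those of first occurrences, so this is the path spelled by [t] once [t] is
    duplicate-free. *)
Definition consecutive t : rel V :=
  fun x y => [&& x \in t, y \in t &
    ((index x t).+1 == index y t) || ((index y t).+1 == index x t)].

Lemma consecutive_sym t : symmetric (consecutive t).
Proof. by move=> x y; rewrite /consecutive andbCA orbC. Qed.

Lemma consecutive_irrefl t : irreflexive (consecutive t).
Proof. by move=> x; rewrite /consecutive; lia. Qed.

Lemma index_mem_inj t x y : x \in t -> index x t = index y t -> x = y.
Proof.
move=> xt e; have yt : y \in t by rewrite -index_mem -e index_mem.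
by rewrite -(nth_index x xt) e nth_index.
Qed.

Lemma consecutive_sorted (e : rel V) t x y :
  sorted e t -> symmetric e -> consecutive t x y -> e x y.
Proof.
move=> e_t e_sym.
wlog xy : x y / (index x t).+1 = index y t.
  move=> IH xy; have /and3P[_ _ /orP[]/eqP idx] := xy; first exact: IH.
  by rewrite e_sym; apply: IH; rewrite // consecutive_sym.
case/and3P=> xt yt _; rewrite -(nth_index x xt) -(nth_index x yt) -xy.
by apply: (sortedP x e_t); rewrite xy index_mem.
Qed.

Lemma consecutive_acyclic t c : 2 < size c -> ~ ucycle (consecutive t) c.
Proof.
move=> c_gt2 /andP[cyc Uc].
have [x0 x0c] : exists x, x \in c.
  by case: c c_gt2 {cyc Uc} => // a c; exists a; rewrite mem_head.
(* At a vertex of c of maximal index, both cyclic neighbours are its predecessor in t. *)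
have [x xc x_max] : exists2 x, x \in c & forall y, y \in c -> index y t <= index x t.
  by case: (@arg_maxnP _ x0 (mem c) (index^~ t) x0c) => x xc x_max; exists x.
have [i c' def_c] := rot_to xc.
have {}x_max y : y \in x :: c' -> index y t <= index x t.
  by rewrite -def_c mem_rot; apply: x_max.
have {c_gt2} : 2 < size (x :: c') by rewrite -def_c size_rot.
move: cyc Uc; rewrite -(rot_cycle i) -(rot_uniq i) def_c.
(* [y] follows and [z] precedes [x] on the cycle; they are separate entries because the length
   exceeds 2. *)
case: c' x_max {def_c} => // y c'; case/lastP: c' => // c' z x_max.
rewrite /cycle rcons_path /= last_rcons => /andP[/andP[xy _] zx].
rewrite mem_rcons !inE => /and3P[_ /norP[y_neq_z _] _] _.
case/eqP: y_neq_z; case/and3P: xy => _ yt xy; case/and3P: zx => _ _ zx.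
have ley := x_max y; have lez := x_max z.
apply: index_mem_inj yt _.
rewrite !inE eqxx orbT in ley; rewrite !inE mem_rcons mem_head !orbT in lez.
by move: xy zx (ley isT) (lez isT); lia.
Qed.

Lemma flatten_uniq_inj s t u x : uniq (flatten s) ->
  t \in s -> u \in s -> x \in t -> x \in u -> t = u.
Proof.
elim: s => //= a s IHs; rewrite cat_uniq => /and3P[_ /hasPn dis Us].
have out v : v \in s -> x \in v -> x \notin a.
  by move=> vs xv; apply: dis; apply/flattenP; exists v.
rewrite !inE => /predU1P[->|ts] /predU1P[->|us] xt xu //.
- by have := out _ us xu; rewrite xt.
- by have := out _ ts xt; rewrite xu.
- exact: IHs.
Qed.

Lemma uniq_of_flatten s t : uniq (flatten s) -> t \in s -> uniq t.
Proof.
elim: s => //= a s IHs; rewrite cat_uniq inE => /and3P[Ua _ Us].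
by case/predU1P=> [->|] //; apply: IHs.
Qed.

Definition path_union_adj s : rel V := fun x y => has (fun t => consecutive t x y) s.

Lemma path_union_adj_sym s : symmetric (path_union_adj s).
Proof. by move=> x y; apply: eq_has => t; rewrite consecutive_sym. Qed.

Lemma path_union_adj_irrefl s : irreflexive (path_union_adj s).
Proof. by move=> x; apply/hasPn => t _; rewrite consecutive_irrefl. Qed.

Lemma path_union_adj_verts s x y :
  path_union_adj s x y -> x \in [set z | z \in flatten s].
Proof. by case/hasP=> t ts /and3P[xt _ _]; rewrite inE; apply/flattenP; exists t. Qed.

Definition path_union s : graph V :=
  Graph (@path_union_adj_sym s) (@path_union_adj_irrefl s) (@path_union_adj_verts s).

Lemma path_union_adjE s t x y : uniq (flatten s) -> t \in s -> x \in t ->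
  path_union_adj s x y = consecutive t x y.
Proof.
move=> Us ts xt; apply/hasP/idP => [[u us xy]|xy]; last by exists t.
by have /and3P[xu _ _] := xy; rewrite (flatten_uniq_inj Us ts us xt xu).
Qed.

(** Every vertex of [t] is joined to the head of [t], by induction on its position. *)
Lemma connect_consecutive (e : rel V) t x y : symmetric e -> uniq t ->
  (forall x y, consecutive t x y -> e x y) ->
  x \in t -> y \in t -> connect e x y.
Proof.
move=> e_sym Ut sub_e xt yt.
have base z : z \in t -> connect e (nth x t 0) z.
  move=> zt; rewrite -(nth_index x zt); have := zt; rewrite -index_mem.
  elim: (index z t) => [|i IHi] lt_i; first exact: connect0.
  apply: connect_trans (IHi (ltnW lt_i)) (connect1 _); apply: sub_e.
  by rewrite /consecutive !mem_nth ?index_uniq ?eqxx // ltnW.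
by apply: connect_trans (base y yt); rewrite (sym_connect_sym e_sym) base.
Qed.

(** Disjointness of the blocks keeps a walk from [x] inside [t]; conversely the path [t] joins its
    own vertices. *)
Lemma path_union_connect s t x y : uniq (flatten s) -> t \in s -> x \in t ->
  connect (path_union_adj s) x y = (y \in t).
Proof.
move=> Us ts xt; apply/idP/idP => [/connectP[p xp ->]|yt].
  elim: p x xt xp => //= z p IHp x xt /andP[xz zp]; apply: IHp zp.
  by rewrite (path_union_adjE _ Us ts xt) in xz; case/and3P: xz.
apply: (@connect_consecutive _ t) => //; first exact: path_union_adj_sym.
  exact: uniq_of_flatten ts.
by move=> a b ab; apply/hasP; exists t.
Qed.

Lemma path_union_component s t x y z : uniq (flatten s) -> t \in s -> x \in t ->
  adj (component (path_union s) x) y z = consecutive t y z.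
Proof.
move=> Us ts xt; rewrite /= /induced_adj /= !inE !(path_union_connect _ Us ts xt).
apply/and3P/idP => [[yt _]|yz]; first by rewrite -(path_union_adjE z Us ts yt).
by have /and3P[yt zt _] := yz; split=> //; apply/hasP; exists t.
Qed.

Lemma path_union_component_tree s t x : uniq (flatten s) -> t \in s -> x \in t ->
  tree (component (path_union s) x).
Proof.
move=> Us ts xt; have compE y z := path_union_component y z Us ts xt.
have vertsE y : (y \in verts (component (path_union s) x)) = (y \in t).
  rewrite /= !inE (path_union_connect _ Us ts xt) andb_idl // => yt.
  by apply/flattenP; exists t.
split; last first.
  move=> c c_gt2; rewrite /ucycle (eq_cycle compE).
  exact: consecutive_acyclic.
split=> [|y z]; first by apply/set0Pn; exists x; rewrite vertsE.
rewrite !vertsE; apply: connect_consecutive; first exact: adj_sym.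
  exact: uniq_of_flatten ts.
by move=> a b; rewrite compE.
Qed.

(** Every edge joins positions [i] and [i.+1] of [t] for some [i] below [(size t).-1]. *)
Lemma card_path_union_component_edges s t x :
  uniq (flatten s) -> t \in s -> x \in t ->
  #|edges (component (path_union s) x)| <= (size t).-1.
Proof.
move=> Us ts xt.
pose f (i : 'I_(size t).-1) : {set V} := [set nth x t i; nth x t i.+1].
suff sub : edges (component (path_union s) x) \subset f @: setT.
  apply: leq_trans (subset_leq_card sub) _; apply: leq_trans (leq_imset_card _ _) _.
  by rewrite cardsT card_ord.
apply/subsetP=> _ /imsetP[[y z] + ->]; rewrite inE [_ (y, z).1 _](path_union_component _ _ Us ts xt) /=.
wlog yz : y z / (index y t).+1 = index z t.
  move=> IH yz; have /and3P[_ _ /orP[]/eqP e] := yz; first exact: IH.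
  by rewrite setUC; apply: IH; rewrite // consecutive_sym.
case/and3P=> yt zt _; have lt_y : index y t < (size t).-1.
  by move: zt; rewrite -index_mem -yz; case: (size t).
by apply/imsetP; exists (Ordinal lt_y); rewrite // /f /= yz !nth_index.
Qed.

(** The neighbours are the predecessor and the successor in [t]: both exist at an interior position,
    and they differ because [t] has no repetition. *)
Lemma path_union_degree s t x : uniq (flatten s) -> t \in s -> x \in t ->
  0 < index x t -> (index x t).+1 < size t -> degree (path_union s) x = 2.
Proof.
move=> Us ts xt x_gt0 x_lt; have Ut := uniq_of_flatten Us ts.
have lt_p : (index x t).-1 < size t by lia.
rewrite /degree; set i := index x t in x_gt0 x_lt lt_p *.
have -> : [set y | adj (path_union s) x y] = [set nth x t i.-1; nth x t i.+1].
  apply/setP=> y; rewrite inE /= (path_union_adjE _ Us ts xt) !inE.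
  apply/idP/idP => [/and3P[_ yt /orP[]/eqP]|/orP[]/eqP->].
  - by rewrite -/i => e; rewrite e nth_index ?eqxx ?orbT.
  - by rewrite -/i => <-; rewrite nth_index ?eqxx.
  - by rewrite /consecutive mem_nth // index_uniq // xt -/i; lia.
  - by rewrite /consecutive mem_nth // index_uniq // xt -/i; lia.
rewrite cards2 nth_uniq //; have -> // : i.-1 != i.+1 by lia.
Qed.

(** The length bound allows at most 4 edges; keeping [L] away from both ends is what gives its
    vertices degree 2. *)
Definition path_block (G : graph V) (L : {set V}) t : Prop :=
  [/\ size t <= 5, sorted (adj G) t &
      forall x, x \in t -> x \in L -> 0 < index x t /\ (index x t).+1 < size t].

Lemma path_union_matching24 G L s : uniq (flatten s) ->
  {subset flatten s <= verts G} -> (forall t, t \in s -> path_block G L t) ->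
  matching24 G L (path_union s).
Proof.
move=> Us sG blocks; split.
- split=> [|x y /hasP[t ts]]; first by apply/subsetP=> x; rewrite inE; apply: sG.
  by have [_ + _] := blocks t ts => /consecutive_sorted; apply=> //; apply: adj_sym.
- move=> x; rewrite inE => /flattenP[t ts xt].
  split; first exact: path_union_component_tree ts xt.
  apply: leq_trans (card_path_union_component_edges Us ts xt) _.
  by have [+ _ _] := blocks t ts; lia.
- move=> x; rewrite !inE => /andP[/flattenP[t ts xt] xL].
  have [_ _ /(_ x xt xL)[x_gt0 x_lt]] := blocks t ts.
  exact: path_union_degree ts xt x_gt0 x_lt.
Qed.

End PathUnion.

(** * Private neighbours and the discharging bound *)

Section Discharging.

Local Open Scope nat_scope.

Variables (V : finType) (G : graph V).
Implicit Types (A B L : {set V}) (k l p q r : V).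

Definition private A l r : bool :=
  adj G l r && [forall k in A, adj G k r ==> (k == l)].

Lemma privateP A l r :
  reflect (adj G l r /\ forall k, k \in A -> adj G k r -> k = l) (private A l r).
Proof.
apply: (iffP andP) => -[lr H]; split=> //.
  by move=> k kA kr; apply/eqP/(implyP _ kr)/(forall_inP H).
by apply/forall_inP=> k kA; apply/implyP=> kr; apply/eqP/H.
Qed.

Lemma notin_neighbours_setD A B r :
  (forall k, k \in A -> adj G k r -> k \in B) -> r \notin neighbours G (A :\: B).
Proof.
move=> H; rewrite inE; apply/existsP=> -[k /andP[/setDP[kA]]].
by move=> kB kr; rewrite (H k kA kr) in kB.
Qed.

Definition charge A l r : nat :=
  if private A l r then 5 else if [exists p, private A l p] then 2 else 3.

Lemma charge_ge2 A l r : 2 <= charge A l r.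
Proof. by rewrite /charge; do 2?case: ifP. Qed.

Lemma sum_charge_le A l : degree G l <= 3 ->
  (forall p q, private A l p -> private A l q -> p = q) ->
  \sum_(r | adj G l r) charge A l r <= 9.
Proof.
move=> deg_l uniq_p; have deg_E : #|[pred r | adj G l r]| <= 3.
  by apply: leq_trans deg_l; rewrite /degree cardsE.
have [/existsP[p lp]|none] := boolP [exists p, private A l p]; last first.
  rewrite (eq_bigr (fun=> 3)) => [|r _].
    by rewrite sum_nat_const -[9]/(3 * 3) leq_mul2r.
  rewrite /charge (negPf none); case: ifP => // lr.
  by case/existsP: none; exists r.
have [l_p _] := privateP _ _ _ lp.
(* [p] contributes 5; by [uniq_p] no other neighbour of [l] is private, so each of the at most two
   others contributes 2. *)
rewrite (bigD1 p) //= {1}/charge lp (eq_bigr (fun=> 2)) => [|r /andP[lr rp]]; last first.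
  rewrite /charge; case: ifP => [/uniq_p/(_ lp) e|_]; first by rewrite e eqxx in rp.
  by case: existsP => // -[]; exists p.
rewrite sum_nat_const -[9]/(5 + 2 * 2) leq_add2l leq_mul2r -ltnS.
apply: leq_trans deg_E; rewrite (cardD1 p [pred r | adj G l r]) inE l_p ltnS.
by apply/eq_leq/eq_card => r; rewrite !inE andbC.
Qed.

(** A private [r] gets 5 from one edge, and three neighbours in [A] give at least 2 + 2 + 2. If
    there are exactly two, the hypothesis forbids both from having private neighbours, so they give
    at least 3 + 2. *)
Lemma sum_charge_ge A r : r \in neighbours G A ->
  (forall l k p q, l \in A -> k \in A -> l != k -> adj G l r -> adj G k r ->
     private A l p -> private A k q ->
     exists m, [/\ m \in A, adj G m r, m != l & m != k]) ->
  5 <= \sum_(l in A | adj G l r) charge A l r.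
Proof.
rewrite inE => /existsP[l /andP[lA lr]] H.
rewrite (bigD1 l) ?lA //=.
have [lp|] := boolP (private A l r); first by rewrite {1}/charge lp leq_addr.
rewrite /private lr /= => /forall_inPn[k kA]; rewrite negb_imply => /andP[kr kl].
rewrite (bigD1 k) ?kA ?kr //=.
have [/existsP[m /and4P[mA mr ml mk]]|none] :=
    boolP [exists m, [&& m \in A, adj G m r, m != l & m != k]].
  rewrite (bigD1 m) ?mA ?mr ?ml //=.
  by have [[]] := (charge_ge2 A l r, charge_ge2 A k r, charge_ge2 A m r); lia.
have {none} : ~~ ([exists p, private A l p] && [exists q, private A k q]).
  apply/andP=> -[/existsP[p lp] /existsP[q kq]]; case/existsP: none.
  have [|m [mA mr ml mk]] := H l k p q lA kA _ lr kr lp kq; first by rewrite eq_sym.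
  by exists m; apply/and4P.
by rewrite /charge; do 4?case: ifP => _ //=; lia.
Qed.

(** Double counting of the total charge, by [r] and then by [l]. The last two hypotheses exclude the
    two path configurations on which the induction removes vertices. *)
Lemma card_neighbours_le A : (forall l, l \in A -> degree G l <= 3) ->
  (forall l p q, l \in A -> private A l p -> private A l q -> p = q) ->
  (forall r l k p q, l \in A -> k \in A -> l != k -> adj G l r -> adj G k r ->
     private A l p -> private A k q ->
     exists m, [/\ m \in A, adj G m r, m != l & m != k]) ->
  5 * #|neighbours G A| <= 9 * #|A|.
Proof.
move=> deg_A uniq_p third.
rewrite mulnC -sum_nat_const mulnC -sum_nat_const.
apply: (@leq_trans (\sum_(r in neighbours G A) \sum_(l in A | adj G l r) charge A l r)).
  by apply: leq_sum => r rA; apply: sum_charge_ge => // l k p q; apply: third.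
rewrite (exchange_big_dep (mem A)) /= => [|r l _ /andP[] //].
apply: leq_sum => l lA; apply: leq_trans (sum_charge_le (deg_A l lA) _); last first.
  by move=> p q; apply: uniq_p.
(* The left sum also asks that [r] lie in [neighbours G A]; passing to all [r] adjacent to [l]
   cannot decrease it. *)
rewrite lA /= [X in X <= _]big_mkcond [X in _ <= X]big_mkcond /=.
by apply: leq_sum => r _; case: (adj G l r); rewrite ?andbF // andbT; case: ifP.
Qed.

(** * Inductive construction of a covering family of disjoint paths *)

Definition covering_blocks L A (s : seq (seq V)) : Prop :=
  [/\ uniq (flatten s), forall t, t \in s -> path_block G L t,
      {subset A <= flatten s} & {subset flatten s <= A :|: neighbours G A}].

(** The last clause of [covering_blocks] confines [s] to [A :\: B] and its neighbours, all avoided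
    by [t]; hence the new path is disjoint from the old ones. *)
Lemma covering_blocks_cons L A B t s :
  B \subset A -> uniq t -> path_block G L t -> {subset B <= t} ->
  {subset t <= A :|: neighbours G A} ->
  (forall x, x \in t -> x \notin (A :\: B) :|: neighbours G (A :\: B)) ->
  covering_blocks L (A :\: B) s -> covering_blocks L A (t :: s).
Proof.
move=> BA Ut block_t Bt tA t_out [Us blocks As sA]; split.
- rewrite /= cat_uniq Ut Us andbT; apply/hasPn=> x /sA xA.
  by apply/negP=> /t_out; rewrite xA.
- by move=> u; rewrite inE => /predU1P[->|/blocks].
- move=> x xA; rewrite mem_cat; have [/Bt->//|xB] := boolP (x \in B).
  by rewrite As ?orbT // inE xB.
- move=> x; rewrite mem_cat => /orP[/tA//|/sA].
  rewrite !inE => /orP[/andP[_ ->]//|/existsP[l /andP[/setDP[lA _] lx]]].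
  by apply/orP; right; apply/existsP; exists l; rewrite lA.
Qed.

(** Strong induction on the size of [A]. Expansion is assumed for all nonempty subsets of [L], so it
    survives the removal of vertices from [A]. *)
Lemma exists_covering_blocks L R A : bipartition G L R -> A \subset L ->
  (forall l, l \in L -> degree G l <= 3) ->
  (forall B, B \subset L -> B != set0 -> 9 * #|B| < 5 * #|neighbours G B|) ->
  exists s, covering_blocks L A s.
Proof.
move=> [_ disLR bip] + deg_L expand.
have notL l r : l \in L -> adj G l r -> r \notin L.
  move=> lL /bip[[_ rR]|[lR _]]; last by rewrite (disjointFr disLR lL) in lR.
  by rewrite (disjointFl disLR rR).
elim: {A}_.+1 {-2}A (ltnSn #|A|) => // n IHn A; rewrite ltnS => cardA AL.
have [->|A_neq0] := eqVneq A set0.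
  by exists [::]; split=> // x; rewrite inE.
have AtoL l : l \in A -> l \in L by move/(subsetP AL).
(* A path [t] may be split off together with [B] if each of its vertices outside [B] lies outside
   [L], has a neighbour in [A], and has no neighbour in [A] beyond [B]. *)
have extend B t : B \subset A -> B != set0 -> uniq t -> path_block G L t ->
    {subset B <= t} ->
    (forall x, x \in t -> x \in B \/ x \notin L /\ (exists2 k, k \in A & adj G k x) /\
       forall k, k \in A -> adj G k x -> k \in B) ->
    exists s, covering_blocks L A s.
  move=> BA B0 Ut block_t Bt tH.
  have [||s cov] := IHn (A :\: B).
  - apply: leq_trans cardA; apply: proper_card; rewrite properEneq subsetDl andbT.
    apply: contraNneq B0 => e; apply/eqP/setP=> x; rewrite in_set0.
    apply/negP=> xB; have := subsetP BA x xB; rewrite -e inE xB //.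
  - exact: subset_trans (subsetDl _ _) AL.
  exists (t :: s); apply: covering_blocks_cons cov => // x /tH.
    case=> [/(subsetP BA)|[_ [[k kA kx] _]]]; rewrite in_setU; first by move->.
    by apply/orP; right; rewrite inE; apply/exists_inP; exists k.
  case=> [xB|[xL [_ xpriv]]]; rewrite in_setU negb_or; apply/andP; split.
  - by rewrite inE xB.
  - rewrite inE; apply/existsP=> -[k /andP[/setDP[kA _] kx]].
    by have := notL k x (AtoL k kA) kx; rewrite (AtoL _ (subsetP BA _ xB)).
  - by apply: contra xL => /setDP[/AtoL].
  - exact: notin_neighbours_setD.
have neq l r : l \in A -> adj G l r -> (l == r) = false.
  by move=> lA lr; apply/eqP=> e; have := notL l r (AtoL l lA) lr; rewrite -e AtoL.
have [/existsP[l /existsP[p /existsP[q /and4P[lA lp lq p_neq_q]]]]|no_cherry] :=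
    boolP [exists l, exists p, exists q,
             [&& l \in A, private A l p, private A l q & p != q]].
  have [l_p only_p] := privateP _ _ _ lp; have [l_q only_q] := privateP _ _ _ lq.
  have [pl ql] := (neq l p lA l_p, neq l q lA l_q).
  have [pL qL] := (notL l p (AtoL l lA) l_p, notL l q (AtoL l lA) l_q).
  apply: (extend [set l] [:: p; l; q]); rewrite ?sub1set //.
  - by apply/set0Pn; exists l; rewrite inE.
  - by rewrite /= !inE negb_or (eq_sym p l) pl p_neq_q ql.
  - split=> [//||x]; first by rewrite /= adj_sym l_p l_q.
    rewrite !inE => /or3P[]/eqP-> xL; rewrite ?xL // in pL qL *.
    by rewrite /= eqxx (eq_sym p l) pl.
  - by move=> x; rewrite !inE => ->; rewrite orbT.
  - move=> x; rewrite !inE => /or3P[]/eqP->; rewrite ?eqxx; [right|by left|right].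
    + by split=> //; split=> [|k kA kp]; [exists l | rewrite inE (only_p k)].
    + by split=> //; split=> [|k kA kp]; [exists l | rewrite inE (only_q k)].
(* The five-vertex path [p]-[l]-[r]-[k]-[q]; by the last clause [r] has no neighbour left in [A]
   once [l] and [k] are removed. *)
pose bad l k r p q := [&& [&& l \in A, k \in A & l != k], adj G l r && adj G k r,
  private A l p && private A k q &
  [forall m in A, adj G m r ==> (m == l) || (m == k)]].
have [/existsP[l /existsP[k /existsP[r /existsP[p /existsP[q]]]]]|no_path] :=
    boolP [exists l, exists k, exists r, exists p, exists q, bad l k r p q].
  case/and4P=> /and3P[lA kA lk] /andP[lr kr] /andP[lp kq] /forall_inP only_r.
  have [l_p only_p] := privateP _ _ _ lp; have [k_q only_q] := privateP _ _ _ kq.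
  have [lL kL] := (AtoL l lA, AtoL k kA).
  have [[pL qL] rL] := (notL l p lL l_p, notL k q kL k_q, notL l r lL lr).
  have neqL x y : x \in L -> y \notin L -> (x == y = false) * (y == x = false).
    by move=> xL yL; rewrite (eq_sym y); split; apply: contraNF yL => /eqP<-.
  (* A coincidence among [p], [r], [q] would make both [l] and [k] neighbours of a private vertex,
     forcing [l = k]. *)
  have pr : p != r by apply: contraNneq lk => e; rewrite (only_p k) // e.
  have pq : p != q by apply: contraNneq lk => e; rewrite (only_p k) // e.
  have rq : r != q by apply: contraNneq lk => e; rewrite (only_q l) // -e.
  apply: (extend [set l; k] [:: p; l; r; k; q]); rewrite ?subUset ?sub1set ?lA //.
  - by apply/set0Pn; exists l; rewrite !inE eqxx.
  - by rewrite /= !inE !negb_or !(neqL _ _ lL pL, neqL _ _ lL rL, neqL _ _ lL qL,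
      neqL _ _ kL pL, neqL _ _ kL rL, neqL _ _ kL qL) pr pq rq lk.
  - split=> [//||x]; first by rewrite /= adj_sym l_p lr adj_sym kr k_q.
    (* Only [l] and [k] can lie in [L]; they sit at the interior positions 1 and 3. *)
    rewrite !inE => /orP[|/or4P[]] /eqP-> xL; rewrite ?xL // in pL qL rL *.
      by rewrite /= eqxx (neqL _ _ lL pL).
    by rewrite /= eqxx (neqL _ _ kL pL) (neqL _ _ kL rL) (negPf lk).
  - by move=> x; rewrite !inE => /orP[]->; rewrite ?orbT.
  - move=> x; rewrite !inE => /orP[|/or4P[]] /eqP->; rewrite ?eqxx ?orbT;
      [right|by left|right|by left|right].
    + by split=> //; split=> [|m mA mp]; [exists l | rewrite !inE (only_p m) ?eqxx].
    + by split=> //; split=> [|m mA mr]; [exists l | rewrite !inE (implyP (only_r m mA))].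
    + by split=> //; split=> [|m mA mq]; [exists k | rewrite !inE (only_q m) ?eqxx ?orbT].
(* With both configurations excluded, the discharging bound contradicts the strict expansion of
   [A]. *)
have := expand A AL A_neq0; rewrite ltnNge card_neighbours_le //.
- by move=> l /AtoL/deg_L.
- move=> l p q lA lp lq; apply/eqP; apply: contraNT no_cherry => pq.
  by apply/existsP; exists l; apply/existsP; exists p; apply/existsP; exists q; apply/and4P.
- move=> r l k p q lA kA lk lr kr lp kq.
  have [/existsP[m /and4P[mA mr ml mk]]|none] :=
    boolP [exists m, [&& m \in A, adj G m r, m != l & m != k]]; first by exists m.
  case/existsP: no_path; exists l; apply/existsP; exists k; apply/existsP; exists r.
  apply/existsP; exists p; apply/existsP; exists q.
  rewrite /bad lA kA lk lr kr lp kq /=; apply/forall_inP=> m mA.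
  apply/implyP=> mr; apply: contraR none; rewrite negb_or => /andP[ml mk].
  by apply/existsP; exists m; apply/and4P.
Qed.

End Discharging.

(** * From the expansion hypothesis to the matching *)

Theorem theorem1 (K : realType) (eps : K) (heps : eps < 1 / 23%:R)
  (V : finType) (G : graph V) (L R : {set V})
  (hLR : bipartition G L R)
  (hdeg : forall x : V, x \in L -> (degree G x <= 3)%N)
  (hexp : forall A : {set V}, A \subset L ->
     (2%:R - eps) * #|A|%:R <= #|neighbours G A|%:R) :
  exists F : graph V, matching24 G L F /\ covers F L.
Proof.
(* Since [eps < 1/23], the factor [2 - eps] exceeds 45/23, hence 9/5; strictness comes from
   [#|B| > 0]. *)
have expand (B : {set V}) : B \subset L -> B != set0 ->
    (9 * #|B| < 5 * #|neighbours G B|)%N.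
  move=> BL; rewrite -card_gt0 => B_gt0; rewrite -(ltr_nat K) !natrM.
  move: (hexp B BL) B_gt0; rewrite -(ltr_nat K).
  by move: (#|B|%:R : K) (#|neighbours G B|%:R : K) heps => b c; nra.
have [s [Us blocks Ls sL]] := exists_covering_blocks hLR (subxx L) hdeg expand.
exists (path_union s); split; last by apply/subsetP=> x /Ls; rewrite inE.
have [vertsE _ _] := hLR; apply: path_union_matching24 => // x /sL.
case/setUP=> [xL|]; first by rewrite -vertsE inE xL.
by rewrite inE => /existsP[l /andP[_]]; rewrite adj_sym => /adj_verts.
Qed.
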